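(* Let $\Gamma$ be a graph (finite or infinite) whose chromatic number $\mathrm{chr}(\Gamma)$ and clique number $\mathrm{clq}(\Gamma)$ are finite (for example, any finite graph). Then the right-angled Artin group $A\Gamma$ is poly-free. Moreover, $$\mathrm{clq}(\Gamma)\le \mathrm{pfl}(A\Gamma)\le \mathrm{chr}(\Gamma),$$ and there exists a poly-free tower for $A\Gamma$ of length $\mathrm{chr}(\Gamma)$.
   Context: All graphs are simple undirected graphs $\Gamma=(V(\Gamma),E(\Gamma))$ (no loops or multiple edges), possibly infinite. The right-angled Artin group $A\Gamma$ is the group with generating set $V(\Gamma)$ and defining relations $vw=wv$ for each edge $\{v,w\}\in E(\Gamma)$. The clique number $\mathrm{clq}(\Gamma)$ is the largest size of a set of pairwise adjacent vertices; the chromatic number $\mathrm{chr}(\Gamma)$ is the smallest number of colors in a proper vertex coloring. A poly-free tower of length $N$ for a group $G$ is a finite chain of subgroups $1=G_0\trianglelefteq G_1\trianglelefteq\cdots\trianglelefteq G_N=G$ (each $G_i$ normal in $G_{i+1}$) such that each quotient $G_{i+1}/G_i$ is a free group (of finite or infinite rank). $G$ is poly-free if it has a poly-free tower; its poly-free length $\mathrm{pfl}(G)$ is the least $N$ for which a poly-free tower of length $N$ exists. *)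

(* Defs.v *)
From HB Require Import structures.
From mathcomp Require Import all_boot.
From mathcomp Require Import boolp classical_sets cardinality.

Set Implicit Arguments.
Unset Strict Implicit.
Unset Printing Implicit Defensive.

Local Open Scope group_scope.
Local Open Scope quotient_scope.

Definition isomorphic (G H : groupType) : Prop :=
  exists f : {multiplicative G -> H}, bijective f.

Section Subgroup.
Variables (G : groupType) (S : groupClosed G).

Definition subgroup_of : Type := {x : G | x \in S}.

HB.instance Definition _ := SubChoice.on subgroup_of.
HB.instance Definition _ :=
  SubChoice_isSubGroup.Build G [in S] subgroup_of
    (conj (@gpred1 G S) (@gpredF G S)).

End Subgroup.

Record normalSubgroup (G : groupType) := NormalSubgroup {
  normal_sub :> groupClosed G;
  normal_subJ : forall x y : G, x \in normal_sub -> x ^ y \in normal_sub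
}.

Section Quotient.
Variables (G : groupType) (N : normalSubgroup G).

Definition coset_rel (x y : G) : bool := x^-1 * y \in N.

Lemma coset_rel_refl : reflexive coset_rel.
Proof. by move=> x; rewrite /coset_rel mulVg gpred1. Qed.

Lemma coset_rel_sym : symmetric coset_rel.
Proof.
by move=> x y; rewrite /coset_rel -[LHS]gpredV invgM invgK.
Qed.

Lemma coset_rel_trans : transitive coset_rel.
Proof.
move=> y x z; rewrite /coset_rel => xy yz.
by have := gpredM _ _ xy yz; rewrite -mulgA mulVKg.
Qed.

Canonical coset_equiv := EquivRel coset_rel
  coset_rel_refl coset_rel_sym coset_rel_trans.

Definition quotient_group : Type := {eq_quot coset_equiv}.
HB.instance Definition _ := Choice.on quotient_group.
HB.instance Definition _ := EqQuotient.on quotient_group.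

Definition coset (x : G) : quotient_group := \pi_quotient_group x.

Definition quotient_one : quotient_group := coset 1.
Definition quotient_mul (a b : quotient_group) : quotient_group :=
  coset (repr a * repr b).
Definition quotient_inv (a : quotient_group) : quotient_group := coset (repr a)^-1.

Lemma coset_eqP (x y : G) :
  (coset x = coset y) <-> (x^-1 * y \in N).
Proof. by split=> [/eqmodP | xy]; last exact/eqmodP. Qed.

Lemma repr_coset (x : G) : x^-1 * repr (coset x) \in N.
Proof. by apply/coset_eqP; rewrite /coset reprK. Qed.

Lemma cosetW (P : quotient_group -> Prop) :
  (forall x, P (coset x)) -> forall a, P a.
Proof. by move=> Px a; rewrite -[a]reprK; apply: Px. Qed.

Lemma quotient_mul_coset (x y : G) :
  quotient_mul (coset x) (coset y) = coset (x * y).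
Proof.
apply/esym/coset_eqP.
have xN := normal_subJ y (repr_coset x); have yN := repr_coset y.
by have := gpredM _ _ xN yN; rewrite /conjg invgM !mulgA mulgK.
Qed.

Lemma quotient_inv_coset (x : G) : quotient_inv (coset x) = coset x^-1.
Proof.
apply/coset_eqP; rewrite invgK.
have := normal_subJ x^-1 (repr_coset x).
by rewrite /conjg invgK !mulgA mulgV mul1g.
Qed.

Lemma quotient_mulA : associative quotient_mul.
Proof.
by elim/cosetW => x; elim/cosetW => y; elim/cosetW => z;
  rewrite !quotient_mul_coset mulgA.
Qed.

Lemma quotient_mul1 : left_id quotient_one quotient_mul.
Proof. by elim/cosetW => x; rewrite quotient_mul_coset mul1g. Qed.

Lemma quotient_mulr1 : right_id quotient_one quotient_mul.
Proof. by elim/cosetW => x; rewrite quotient_mul_coset mulg1. Qed.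

Lemma quotient_mulV : left_inverse quotient_one quotient_inv quotient_mul.
Proof. by elim/cosetW => x; rewrite quotient_inv_coset quotient_mul_coset mulVg. Qed.

Lemma quotient_mulVr : right_inverse quotient_one quotient_inv quotient_mul.
Proof. by elim/cosetW => x; rewrite quotient_inv_coset quotient_mul_coset mulgV. Qed.

HB.instance Definition _ := isGroup.Build quotient_group
  quotient_mulA quotient_mul1 quotient_mulr1 quotient_mulV quotient_mulVr.

End Quotient.

Section FreeGroup.
Variable X : Type.

(* The letter (x, true) stands for x and (x, false) for its inverse. *)
Definition word : Type := seq ({classic X} * bool).
HB.instance Definition _ := Choice.on word.

Inductive free_eq : word -> word -> Prop :=
| free_eq_refl u : free_eq u u
| free_eq_sym u v : free_eq u v -> free_eq v u
| free_eq_trans u v w : free_eq u v -> free_eq v w -> free_eq u w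
| free_eq_cancel u v x b : free_eq (u ++ (x, b) :: (x, ~~ b) :: v) (u ++ v).

Definition free_rel (u v : word) : bool := `[< free_eq u v >].

Lemma free_rel_refl : reflexive free_rel.
Proof. by move=> u; apply/asboolP/free_eq_refl. Qed.

Lemma free_rel_sym : symmetric free_rel.
Proof. by move=> u v; apply/asboolP/asboolP; apply: free_eq_sym. Qed.

Lemma free_rel_trans : transitive free_rel.
Proof.
by move=> v u w /asboolP uv /asboolP vw; apply/asboolP/(free_eq_trans uv).
Qed.

Canonical free_equiv := EquivRel free_rel
  free_rel_refl free_rel_sym free_rel_trans.

Definition free_group : Type := {eq_quot free_equiv}.
HB.instance Definition _ := Choice.on free_group.
HB.instance Definition _ := EqQuotient.on free_group.

Definition word_inv (u : word) : word := rev [seq (a.1, ~~ a.2) | a <- u].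

Definition of_word (u : word) : free_group := \pi_free_group u.

Definition free_one : free_group := of_word [::].
Definition free_mul (a b : free_group) : free_group :=
  of_word (repr a ++ repr b).
Definition free_inv (a : free_group) : free_group := of_word (word_inv (repr a)).

Lemma of_word_eqP (u v : word) :
  (of_word u = of_word v) <-> free_eq u v.
Proof.
by split=> [/eqmodP/asboolP | uv]; last by apply/eqmodP/asboolP.
Qed.

Lemma repr_of_word (u : word) : free_eq (repr (of_word u)) u.
Proof. by apply/of_word_eqP; rewrite /of_word reprK. Qed.

Lemma of_wordW (P : free_group -> Prop) :
  (forall u, P (of_word u)) -> forall a, P a.
Proof. by move=> Pu a; rewrite -[a]reprK; apply: Pu. Qed.

Lemma free_eq_cat2 (u u' v v' : word) :
  free_eq u u' -> free_eq v v' -> free_eq (u ++ v) (u' ++ v').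
Proof.
move=> uu' vv'; apply: (@free_eq_trans _ (u' ++ v)).
  elim: uu' => {u u'} [u|u w _|u w t _ + _|u w x b].
  - exact: free_eq_refl.
  - exact: free_eq_sym.
  - exact: free_eq_trans.
  - by rewrite -!catA /=; apply: free_eq_cancel.
elim: vv' => {v v'} [v|v w _|v w t _ + _|v w x b].
- exact: free_eq_refl.
- exact: free_eq_sym.
- exact: free_eq_trans.
- by rewrite !catA; apply: free_eq_cancel.
Qed.

Lemma free_eq_inv (u v : word) :
  free_eq u v -> free_eq (word_inv u) (word_inv v).
Proof.
elim=> {u v} [u|u w _|u w t _ + _|u w x b].
- exact: free_eq_refl.
- exact: free_eq_sym.
- exact: free_eq_trans.
- rewrite /word_inv !map_cat /= !rev_cat !rev_cons -!cats1 -!catA /=.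
  by rewrite negbK; apply: free_eq_cancel.
Qed.

Lemma free_eq_invr (u : word) : free_eq (u ++ word_inv u) [::].
Proof.
elim: u => [|[x b] u IH]; first exact: free_eq_refl.
rewrite /word_inv /= rev_cons -cats1 catA.
have h := free_eq_cat2 (free_eq_cat2 (free_eq_refl [:: (x, b)]) IH)
  (free_eq_refl [:: (x, ~~ b)]).
by apply: (free_eq_trans h); apply: (@free_eq_cancel [::] [::]).
Qed.

Lemma word_invK : involutive word_inv.
Proof.
move=> u; rewrite /word_inv map_rev revK -map_comp -[RHS]map_id.
by apply: eq_map => -[x b] /=; rewrite negbK.
Qed.

Lemma free_mul_of_word (u v : word) : free_mul (of_word u) (of_word v) = of_word (u ++ v).
Proof. by apply/of_word_eqP; apply: free_eq_cat2; apply: repr_of_word. Qed.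

Lemma free_inv_of_word (u : word) : free_inv (of_word u) = of_word (word_inv u).
Proof. by apply/of_word_eqP; apply: free_eq_inv; apply: repr_of_word. Qed.

Lemma free_mulA : associative free_mul.
Proof.
by elim/of_wordW => x; elim/of_wordW => y; elim/of_wordW => z;
  rewrite !free_mul_of_word catA.
Qed.

Lemma free_mul1 : left_id free_one free_mul.
Proof. by elim/of_wordW => x; rewrite free_mul_of_word. Qed.

Lemma free_mulr1 : right_id free_one free_mul.
Proof. by elim/of_wordW => x; rewrite free_mul_of_word cats0. Qed.

Lemma free_mulVr : right_inverse free_one free_inv free_mul.
Proof.
elim/of_wordW => x; rewrite free_inv_of_word free_mul_of_word.
by apply/of_word_eqP; apply: free_eq_invr.
Qed.

Lemma free_mulV : left_inverse free_one free_inv free_mul.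
Proof.
elim/of_wordW => x; rewrite free_inv_of_word free_mul_of_word.
by apply/of_word_eqP; have := free_eq_invr (word_inv x); rewrite word_invK.
Qed.

HB.instance Definition _ := isGroup.Build free_group
  free_mulA free_mul1 free_mulr1 free_mulV free_mulVr.

Definition free_gen (x : X) : free_group := of_word [:: (x, true)].

End FreeGroup.

Definition is_free_group (G : groupType) : Prop :=
  exists X : Type, isomorphic G (free_group X).

Section NormalClosure.
Variables (G : groupType) (R : set G).

Definition normal_closure : {pred G} :=
  fun x => `[< forall N : normalSubgroup G,
                 (forall r, R r -> r \in N) -> x \in N >].

Lemma normal_closureP (x : G) :
  reflect (forall N : normalSubgroup G, (forall r, R r -> r \in N) -> x \in N)
          (x \in normal_closure).
Proof. exact: asboolP. Qed.

Lemma normal_closure1 : 1 \in normal_closure.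
Proof. by apply/normal_closureP => N _; apply: gpred1. Qed.

Lemma normal_closureM : mulg_closed normal_closure.
Proof.
move=> x y /normal_closureP xR /normal_closureP yR.
by apply/normal_closureP => N RN; rewrite gpredM ?xR ?yR.
Qed.

Lemma normal_closureV : invg_closed normal_closure.
Proof.
move=> x /normal_closureP xR.
by apply/normal_closureP => N RN; rewrite gpredVr ?xR.
Qed.

HB.instance Definition _ := isMulClosed.Build G normal_closure normal_closureM.
HB.instance Definition _ := isMul1Closed.Build G normal_closure normal_closure1.
HB.instance Definition _ := isInvClosed.Build G normal_closure normal_closureV.

Lemma normal_closureJ (x y : G) :
  x \in normal_closure -> x ^ y \in normal_closure.
Proof.
move=> /normal_closureP xR; apply/normal_closureP => N RN.
by apply: normal_subJ; apply: xR.
Qed.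

Definition normal_closure_sub : normalSubgroup G :=
  NormalSubgroup normal_closureJ.

End NormalClosure.

Definition presented_group (X : Type) (R : set (free_group X)) : groupType :=
  quotient_group (normal_closure_sub R).

Record graph := Graph {
  vertex :> Type;
  edge : vertex -> vertex -> Prop;
  edge_sym : forall v w, edge v w -> edge w v;
  edge_irrefl : forall v, ~ edge v v
}.

Definition clique (Gamma : graph) (K : set Gamma) : Prop :=
  forall v w, K v -> K w -> v <> w -> edge v w.

Definition colorable (Gamma : graph) (k : nat) : Prop :=
  exists c : Gamma -> 'I_k, forall v w, edge v w -> c v <> c w.

Definition is_least (P : nat -> Prop) (n : nat) : Prop :=
  P n /\ forall m, P m -> n <= m.

(* "is_clq Gamma q" (resp. "is_chr Gamma k") says that the clique (resp.      *)
(* chromatic) number of the possibly infinite graph Gamma is finite, equal to *)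
(* q (resp. k).                                                               *)
Definition is_clq (Gamma : graph) (q : nat) : Prop :=
  (exists2 K : set Gamma, clique K & (K #= `I_q)%card) /\
  (forall K : set Gamma, clique K -> (K #<= `I_q)%card).

Definition is_chr (Gamma : graph) (k : nat) : Prop :=
  is_least (colorable Gamma) k.

Definition raag (Gamma : graph) : groupType :=
  @presented_group Gamma
    [set r | exists v w : Gamma,
       edge v w /\ r = [~ free_gen v, free_gen w]]%classic.

Section Normal.
Variable G : groupType.

Definition normal_in (A B : groupClosed G) : Prop :=
  {subset A <= B} /\ forall a b, a \in A -> b \in B -> a ^ b \in A.

Variables (A B : groupClosed G).

Definition in_subgroup : {pred subgroup_of B} := fun x => val x \in A.

Lemma in_subgroup1 : 1 \in in_subgroup.
Proof. by rewrite unfold_in val1 gpred1. Qed.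

Lemma in_subgroupM : mulg_closed in_subgroup.
Proof. by move=> x y xA yA; rewrite unfold_in valM gpredM. Qed.

Lemma in_subgroupV : invg_closed in_subgroup.
Proof. by move=> x xA; rewrite unfold_in gmulfV gpredVr. Qed.

HB.instance Definition _ := isMulClosed.Build _ in_subgroup in_subgroupM.
HB.instance Definition _ := isMul1Closed.Build _ in_subgroup in_subgroup1.
HB.instance Definition _ := isInvClosed.Build _ in_subgroup in_subgroupV.

Hypothesis nAB : normal_in A B.

Lemma in_subgroupJ (x y : subgroup_of B) :
  x \in in_subgroup -> x ^ y \in in_subgroup.
Proof.
move=> xA; rewrite unfold_in gmulfJ.
by apply: nAB.2 => //; apply: (valP y).
Qed.

Definition factor_group : groupType :=
  quotient_group (NormalSubgroup in_subgroupJ).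

End Normal.

(* Only the values T 0, ..., T N of the sequence T are relevant. *)
Definition poly_free_tower (G : groupType) (N : nat)
    (T : nat -> groupClosed G) : Prop :=
  [/\ T 0 =i pred1 1, T N =i predT &
      forall i, i < N -> exists nT : normal_in (T i) (T i.+1),
        is_free_group (factor_group nT)].

Definition has_poly_free_tower (G : groupType) (N : nat) : Prop :=
  exists T : nat -> groupClosed G, poly_free_tower N T.

Definition poly_free (G : groupType) : Prop :=
  exists N : nat, has_poly_free_tower G N.

Definition is_pfl (G : groupType) (n : nat) : Prop :=
  is_least (has_poly_free_tower G) n.

(* Main.v *)
Require Import Defs.
From HB Require Import structures.
From mathcomp Require Import all_boot all_algebra.
From mathcomp Require Import boolp classical_sets functions cardinality.
From mathcomp Require Import zify.

(** Upper bound. Given a colouring by 0, ..., k-1, let rho_i be the retraction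
    of the Artin group G that kills the generators of colour < i. The kernels of
    rho_0 = id, ..., rho_k = 1 form a tower, and rho_i maps the factor
    ker rho_(i+1) / ker rho_i isomorphically onto the subgroup generated by the
    set X of all conjugates s ^ h, where s has colour i and h is in the image of
    rho_(i+1). This subgroup is free on X: since colour classes are independent,
    G acts on the free group over (the set) G, generators of colour i by left
    translation, those of larger colour by conjugating the free generators, the
    others trivially; an element of <X> then acts as left translation by the
    corresponding free word.

    Lower bound. A clique of size q generates a subgroup 'Z^q. Each step of a
    tower can lower the rank of a free abelian subgroup by at most one, because
    commuting elements of a free group have a common power. *)

Set Implicit Arguments.
Unset Strict Implicit.
Unset Printing Implicit Defensive.

Import GRing.Theory.
Local Open Scope group_scope.
Local Open Scope quotient_scope.

(** * Morphisms of groups and their kernels *)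

Section Morphisms.
Variables G H : groupType.

Lemma morph_group1 (f : G -> H) : {morph f : x y / x * y} -> f 1 = 1.
Proof. by move=> fM; apply: (mulgI (f 1)); rewrite -fM !mulg1. Qed.

Lemma morph_groupV (f : G -> H) :
  {morph f : x y / x * y} -> {morph f : x / x^-1}.
Proof.
by move=> fM x; apply: (mulgI (f x)); rewrite -fM !mulgV; apply: morph_group1.
Qed.

Lemma group_morphism (f : G -> H) :
  {morph f : x y / x * y} -> exists g : {multiplicative G -> H}, g =1 f.
Proof.
move=> fM; pose fm := isMultiplicative.Build G H f fM.
by exists (HB.pack_for {multiplicative G -> H} f fm).
Qed.

Definition kernel (f : G -> H) : {pred G} := fun x => f x == 1.

Lemma kernelE (f : G -> H) x : (x \in kernel f) = (f x == 1).
Proof. by []. Qed.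

Variable f : UMagmaMorphism.type G H.

Lemma kernel1 : 1 \in kernel f.
Proof. by rewrite kernelE gmulf1. Qed.

Lemma kernelM : mulg_closed (kernel f).
Proof.
by move=> x y; rewrite !kernelE gmulfM => /eqP-> /eqP->; rewrite mulg1.
Qed.

Lemma kernelV : invg_closed (kernel f).
Proof. by move=> x; rewrite !kernelE gmulfV invg_eq1. Qed.

HB.instance Definition _ := isMulClosed.Build G (kernel f) kernelM.
HB.instance Definition _ := isMul1Closed.Build G (kernel f) kernel1.
HB.instance Definition _ := isInvClosed.Build G (kernel f) kernelV.

Lemma kernelJ (x y : G) : x \in kernel f -> x ^ y \in kernel f.
Proof. by rewrite !kernelE gmulfJ => /eqP->; rewrite conj1g. Qed.

Definition kernel_normal : normalSubgroup G := NormalSubgroup kernelJ.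

End Morphisms.

(** * Universal property of free groups *)

Section FreeLift.
Variables (X : Type) (G : groupType) (h : X -> G).

Definition letter_value (a : {classic X} * bool) : G :=
  if a.2 then h a.1 else (h a.1)^-1.

Definition word_value (u : word X) : G := \prod_(a <- u) letter_value a.

Lemma word_value_free_eq (u v : word X) :
  free_eq u v -> word_value u = word_value v.
Proof.
elim=> {u v} [//|u v _ -> //|u v w _ -> _ -> //|u v x b].
rewrite /word_value !big_cat !big_cons /= [in LHS]/letter_value /=.
by case: b; rewrite /= ?mulKg ?mulVKg.
Qed.

Definition free_lift (a : free_group X) : G := word_value (repr a).

Lemma free_lift_of_word u : free_lift (of_word u) = word_value u.
Proof. exact/word_value_free_eq/repr_of_word. Qed.

Lemma free_liftM : {morph free_lift : x y / x * y}.
Proof.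
elim/of_wordW => u; elim/of_wordW => v.
have -> : of_word u * of_word v = of_word (u ++ v) by apply: free_mul_of_word.
by rewrite !free_lift_of_word /word_value big_cat.
Qed.

Lemma free_lift1 : free_lift 1 = 1.
Proof. exact/morph_group1/free_liftM. Qed.

HB.instance Definition _ :=
  isUMagmaMorphism.Build (free_group X) G free_lift
    (conj free_lift1 free_liftM).

Lemma free_lift_gen x : free_lift (free_gen x) = h x.
Proof. by rewrite free_lift_of_word /word_value big_seq1. Qed.

End FreeLift.

Lemma free_group_ind (X : Type) (P : free_group X -> Prop) :
  P 1 -> (forall x y, P x -> P y -> P (x * y)) -> (forall x, P x -> P x^-1) ->
  (forall x, P (free_gen x)) -> forall a, P a.
Proof.
move=> P1 PM PV Pg; elim/of_wordW; elim=> [//|[x b] u IH].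
have -> : of_word ((x, b) :: u) = of_word [:: (x, b)] * of_word u.
  by symmetry; apply: (@free_mul_of_word X [:: (x, b)] u).
apply: PM => //; case: b; first exact: Pg.
have -> : of_word [:: (x, false)] = (free_gen x)^-1; last exact/PV/Pg.
by symmetry; apply: (@free_inv_of_word X [:: (x, true)]).
Qed.

(** * Universal property of right-angled Artin groups *)

Section Raag.
Variable Gamma : graph.

Definition raag_gen (v : Gamma) : raag Gamma := coset _ (free_gen v).

Lemma cosetM (G : groupType) (N : normalSubgroup G) :
  {morph coset N : x y / x * y}.
Proof. by move=> x y; symmetry; apply: quotient_mul_coset. Qed.

Lemma raag_genC (v w : Gamma) : edge v w -> commute (raag_gen v) (raag_gen w).
Proof.
move=> vw; rewrite /commute /raag_gen -!cosetM; apply/esym/coset_eqP.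
apply/normal_closureP => N; apply; exists v, w; split=> //.
by rewrite invgM -mulgA.
Qed.

Lemma raag_ind (P : raag Gamma -> Prop) :
  P 1 -> (forall x y, P x -> P y -> P (x * y)) -> (forall x, P x -> P x^-1) ->
  (forall v, P (raag_gen v)) -> forall a, P a.
Proof.
move=> P1 PM PV Pg; elim/cosetW; apply: free_group_ind => //.
- by move=> x y Px Py; rewrite cosetM; apply: PM.
- by move=> x Px; rewrite (morph_groupV (@cosetM _ _)); apply: PV.
Qed.

Variables (G : groupType) (h : Gamma -> G).
Hypothesis hC : forall v w, edge v w -> commute (h v) (h w).

(** The kernel of [free_lift h] is a normal subgroup that contains the relators, hence their normal
    closure. *)
Lemma free_lift_coset (x y : free_group Gamma) :
  coset (normal_closure_sub
    [set r | exists v w : Gamma,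
       edge v w /\ r = [~ free_gen v, free_gen w]]%classic) x = coset _ y ->
  free_lift h x = free_lift h y.
Proof.
move=> /coset_eqP/normal_closureP/(_ (kernel_normal (free_lift h)))/=.
rewrite kernelE gmulfM gmulfV /= => hxy.
apply: invg_inj; apply: (mulIg (free_lift h y)); rewrite mulVg.
apply/eqP/hxy => _ [v [w [/hC vw ->]]].
by rewrite kernelE gmulfR /= !free_lift_gen; apply/commgP.
Qed.

(** The body does not mention [hC]; the explicit argument keeps the proof inside the term, where the
    morphism instance below can find it. *)
Definition raag_lift (hC : forall v w, edge v w -> commute (h v) (h w))
  (a : raag Gamma) : G := free_lift h (repr a).

Lemma raag_lift_coset x : raag_lift hC (coset _ x) = free_lift h x.
Proof. by apply: free_lift_coset; rewrite /coset reprK. Qed.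

Lemma raag_liftM : {morph raag_lift hC : x y / x * y}.
Proof.
by elim/cosetW => x; elim/cosetW => y; rewrite -cosetM !raag_lift_coset gmulfM.
Qed.

Lemma raag_lift1 : raag_lift hC 1 = 1.
Proof. exact/morph_group1/raag_liftM. Qed.

HB.instance Definition _ :=
  isUMagmaMorphism.Build (raag Gamma) G (raag_lift hC)
    (conj raag_lift1 raag_liftM).

Lemma raag_lift_gen v : raag_lift hC (raag_gen v) = h v.
Proof. by rewrite raag_lift_coset free_lift_gen. Qed.

End Raag.

(** * Integer powers *)

Section IntegerPowers.
Variable G : groupType.
Implicit Types (x y : G) (m n : int).

Definition intexp x m : G :=
  match m with Posz n => x ^+ n | Negz n => x ^- n.+1 end.

Lemma intexp_succ x m : intexp x (m + 1)%R = intexp x m * x.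
Proof.
case: m => n; first by rewrite addrC -intS /= expgSr.
have -> : (Negz n + 1 = - n%:Z)%R by lia.
rewrite [intexp x (Negz n)]/= expgS invgM mulgVK.
by case: n => [|n]; rewrite -?NegzE // oppr0 expg0 invg1.
Qed.

Lemma intexp_pred x m : intexp x (m - 1)%R = intexp x m / x.
Proof. by apply: (mulIg x); rewrite mulgVK -intexp_succ subrK. Qed.

Lemma intexpD x m n : intexp x (m + n)%R = intexp x m * intexp x n.
Proof.
elim/int_rect: n => [|n IH|n IH]; first by rewrite addr0 /= mulg1.
- by rewrite [Posz _]intS [(1 + _)%R]addrC addrA !intexp_succ IH mulgA.
- by rewrite intS opprD [(-1 - _)%R]addrC addrA !intexp_pred IH mulgA.
Qed.

Lemma intexpN x m : intexp x (- m)%R = (intexp x m)^-1.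
Proof. by apply: (mulIg (intexp x m)); rewrite mulVg -intexpD addNr. Qed.

Lemma commute_intexp x y m : commute x y -> commute x (intexp y m).
Proof.
by case: m => n xy; [apply: commuteX | apply/commuteV/commuteX].
Qed.

Lemma intexpJ x y m : intexp (x ^ y) m = intexp x m ^ y.
Proof. by case: m => n /=; rewrite ?conjVg conjXg. Qed.

End IntegerPowers.

Lemma gmulf_intexp (G H : groupType) (f : UMagmaMorphism.type G H) m :
  {morph f : x / intexp x m}.
Proof. by case: m => n x; rewrite /= ?gmulfXVn ?gmulfXn. Qed.

(** * Reduced words and commuting elements of a free group *)

Section ReducedWords.
Variable X : Type.
Implicit Types (a b : {classic X} * bool) (u v w c : word X).

Definition letter_inv a := (a.1, ~~ a.2).

Lemma letter_invK : involutive letter_inv.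
Proof. by case=> x b; rewrite /letter_inv /= negbK. Qed.

Lemma letter_inv_neq a : a != letter_inv a.
Proof. by case: a => x b; rewrite xpair_eqE; case: b; rewrite andbF. Qed.

Definition reduced u := sorted (fun a b => b != letter_inv a) u.

Definition push a u :=
  if u is b :: u' then if b == letter_inv a then u' else a :: u else [:: a].

Definition reduce u := foldr push [::] u.

Lemma push_reduced a u : reduced u -> reduced (push a u).
Proof.
case: u => [//|b u] ru /=; case: eqP => [_|/eqP ba].
  exact: path_sorted ru.
by rewrite /reduced /= ba.
Qed.

Lemma reduce_reduced u : reduced (reduce u).
Proof. by elim: u => [//|a u IH]; apply: push_reduced. Qed.

(** Letters act on reduced words by permutations. Hence [reduce] does not see cancellations, and
    reduced forms are unique without a confluence argument. *)
Lemma pushK a u : reduced u -> push a (push (letter_inv a) u) = u.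
Proof.
case: u => [|b u] /=; first by rewrite eqxx.
rewrite letter_invK; case: (eqVneq b a) => [-> | _ _] /=; last by rewrite eqxx.
by case: u => [//|d u] /= /andP[/negPf->].
Qed.

Lemma reduce_cat u v : reduce (u ++ v) = foldr push (reduce v) u.
Proof. exact: foldr_cat. Qed.

Lemma reduce_free_eq u v : free_eq u v -> reduce u = reduce v.
Proof.
elim=> {u v} [//|u v _ -> //|u v w _ -> _ -> //|u v x b].
rewrite !reduce_cat /=; congr foldr.
by rewrite -[(x, ~~ b)]/(letter_inv (x, b)) pushK ?reduce_reduced.
Qed.

Lemma of_word_cat u v : of_word (u ++ v) = of_word u * of_word v.
Proof. by symmetry; apply: free_mul_of_word. Qed.

Lemma of_word_inv u : of_word (word_inv u) = (of_word u)^-1.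
Proof. by symmetry; apply: free_inv_of_word. Qed.

Lemma of_word_reduce u : of_word (reduce u) = of_word u.
Proof.
elim: u => [//|a u IH] /=; rewrite -cat1s of_word_cat -{}IH -of_word_cat /=.
case: (reduce u) => [//|b v] /=; case: eqP => [-> | //].
by apply/esym/of_word_eqP; case: a => x e; apply: (@free_eq_cancel _ [::]).
Qed.

Lemma reduced_reduce u : reduced u -> reduce u = u.
Proof.
elim: u => [//|a u IH] ru /=; rewrite IH; last exact: path_sorted ru.
by case: u ru {IH} => [//|b u] /= /andP[/negPf->].
Qed.

(** The equality case is what matters later: a word as short as its reduced form is that form. *)
Lemma size_reduce u : size (reduce u) <= size u ?= iff (reduce u == u).
Proof.
elim: u => [//|a u IH] /=.
have [sz e] := IH; split.
  by case: (reduce u) sz => [//|b v] /=; case: eqP => //= _; lia.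
case: (reduce u) sz e => [|b v] /=; first by rewrite eqSS eqseq_cons eqxx.
move=> sz e; case: (b =P _) => [_|_]; last by rewrite eqSS e eqseq_cons eqxx.
transitivity false; last by symmetry; apply/eqP => /(congr1 size) /=; lia.
by apply/eqP; lia.
Qed.

Lemma of_word_inj u v : reduced u -> reduced v -> of_word u = of_word v ->
  u = v.
Proof.
move=> /reduced_reduce {2}<- /reduced_reduce {2}<- /of_word_eqP.
exact: reduce_free_eq.
Qed.

Lemma reducedP (x : free_group X) : exists2 u, reduced u & x = of_word u.
Proof.
elim/of_wordW: x => u; exists (reduce u); first exact: reduce_reduced.
by rewrite of_word_reduce.
Qed.

Lemma reduced_inv u : reduced u -> reduced (word_inv u).
Proof.
rewrite /reduced /word_inv rev_sorted sorted_map => ru.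
apply: sub_sorted ru => a b /=; apply: contraNN => /eqP ba.
by rewrite -[b]letter_invK -[letter_inv b]/(b.1, ~~ b.2) -ba.
Qed.

Lemma reduced_catl u v : reduced (u ++ v) -> reduced u.
Proof. by case: u => [//|a u]; rewrite /reduced /= cat_path => /andP[]. Qed.

Lemma reduced_cat u a b v :
  reduced (rcons u a ++ b :: v) =
  [&& reduced (rcons u a), b != letter_inv a & reduced (b :: v)].
Proof.
case: u => [|d u]; rewrite /reduced //= cat_path /=.
by rewrite last_rcons.
Qed.

(** Reducedness of [c ++ c] says at once that [c] is reduced and that its last letter does not
    cancel its first. *)
Definition cyclically_reduced c := c != [::] /\ reduced (c ++ c).

Lemma cyclically_reduced_inv c :
  cyclically_reduced c -> cyclically_reduced (word_inv c).
Proof.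
move=> [c0 rc]; split.
  by apply: contra c0 => /eqP/(congr1 (@word_inv X)); rewrite word_invK => ->.
by have := reduced_inv rc; rewrite /word_inv map_cat rev_cat.
Qed.

(** [v ++ u] represents the same element as the reduced word [u ++ v] and has the same length, so no
    letter of it can cancel. *)
Lemma cat_comm_of_commute u v :
  reduced (u ++ v) -> commute (of_word u) (of_word v) -> u ++ v = v ++ u.
Proof.
rewrite /commute -!of_word_cat => ruv e.
have e' : reduce (v ++ u) = u ++ v.
  by apply: of_word_inj => //; rewrite ?reduce_reduced // of_word_reduce.
rewrite -e'; apply/eqP; rewrite -(size_reduce (v ++ u)) e'.
by rewrite !size_cat addnC.
Qed.

(* A reduced word commuting with a cyclically reduced c labels an initial
   segment of the axis of c, in one of the two directions. *)
Lemma centralizer_axis c (y : word X) :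
  cyclically_reduced c -> reduced y -> commute (of_word c) (of_word y) ->
  exists (m : int) (k : 'I_(size c).+1) (s : bool),
    of_word y =
      intexp (of_word c) m * of_word (take k (if s then c else word_inv c)).
Proof.
move=> cyc; have [n] := ubnP (size y); elim: n y => // n IH y yn ry cy.
have sz_inv : size (word_inv c) = size c by rewrite /word_inv size_rev size_map.
(* If [d] is [c] or its inverse and does not cancel against [y], then [d ++ y = y ++ d]. So either
   [y] is a prefix of [d], or [d] is a prefix of [y] and the induction hypothesis applies to the
   rest. *)
have step (d : word X) (e : int) (s : bool) :
  d = (if s then c else word_inv c) -> of_word d = intexp (of_word c) e ->
  d != [::] -> reduced (d ++ y) -> commute (of_word d) (of_word y) ->
  exists (m : int) (k : 'I_(size c).+1) (s : bool),
    of_word y =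
      intexp (of_word c) m * of_word (take k (if s then c else word_inv c)).
  move=> ds de d0 rdy dy; have ydC := cat_comm_of_commute rdy dy.
  have dc : size d = size c by rewrite ds; case: (s).
  have [yd|yd] := leqP (size y) (size d).
    have yc : size y < (size c).+1 by rewrite ltnS -dc.
    exists 0%R, (Ordinal yc), s; rewrite /= mul1g -ds.
    have := congr1 (take (size y)) ydC.
    by rewrite takel_cat // take_size_cat // => ->.
  have yE : y = d ++ drop (size d) y.
    have := congr1 (take (size d)) ydC.
    rewrite take_size_cat // takel_cat ?(ltnW yd) // => {1}->.
    by rewrite cat_take_drop.
  have ry' : reduced (drop (size d) y) by exact: drop_sorted.
  have sy' : size (drop (size d) y) < n.
    by rewrite size_drop; case: (d) d0 yd yn => //= ? ?; lia.
  have y'E : of_word (drop (size d) y) = (of_word d)^-1 * of_word y.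
    by rewrite {2}yE of_word_cat mulKg.
  have /IH[] // : commute (of_word c) (of_word (drop (size d) y)).
    rewrite y'E; apply: commuteM => //; apply: commuteV.
    by rewrite de; apply: commute_intexp.
  move=> m [k [s' e']]; exists (e + m)%R, k, s'.
  by rewrite intexpD -mulgA -e' y'E de mulVKg.
have [yc|nyc] := boolP (reduced (c ++ y)).
  by apply: (step c 1%R true) => //; case: cyc.
have [c0' rcc'] := cyclically_reduced_inv cyc.
(* If [c] cancels against [y], its inverse does not: otherwise the first letter of [y] would be both
   the first letter of [c] and the inverse of its last one, so [c ++ c] would not be reduced. *)
apply: (step (word_inv c) (-1)%R false) => //; first by rewrite of_word_inv.
  case: cyc => c0 rcc {step c0' IH cy}.
  case: y ry nyc {yn} => [|a y] ry; first by rewrite cats0 (reduced_catl rcc).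
  case: c / lastP c0 rcc rcc' sz_inv => // c l _.
  case: c => [|h c] rcc rcc' _.
    rewrite (reduced_cat [::]) ry /= andbT negbK /word_inv /= => /eqP al.
    by move: ry; rewrite al /reduced /= letter_inv_neq.
  rewrite reduced_cat ry andbT (reduced_catl rcc) negbK => /eqP al.
  have := rcc'; rewrite /word_inv /= rev_cons => /reduced_catl r1.
  rewrite reduced_cat r1 ry andbT /=.
  have := rcc; rewrite [rcons (h :: c) l ++ _]/= -/(rcons (h::c) l).
  rewrite -[_ :: _]/(rcons (h :: c) l ++ h :: rcons c l) reduced_cat.
  move=> /and3P[_ + _].
  by rewrite al; apply: contra => /eqP; rewrite letter_invK => <-.
by rewrite of_word_inv; apply/commute_sym/commuteV/commute_sym.
Qed.

(** While the last letter of a reduced word cancels its first, conjugating by the first letter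
    strips both; the length decreases. *)
Lemma conj_cyclically_reduced (x : free_group X) :
  x != 1 -> exists g c, cyclically_reduced c /\ x ^ g = of_word c.
Proof.
have [u ru ->] := reducedP x; have [n] := ubnP (size u).
elim: n u ru {x} => // n IH u ru un u1.
have u0 : u != [::] by apply: contra u1 => /eqP->.
have [ruu|] := boolP (reduced (u ++ u)).
  by exists 1, u; rewrite conjg1.
case: u u0 ru un u1 => // a u _; case: u / lastP => [|u b] ru un u1.
  by case/negP; rewrite /reduced /= letter_inv_neq.
rewrite -rcons_cons reduced_cat rcons_cons ru andbT /= negbK => /eqP ab.
have ru' : reduced u.
  by apply: (@reduced_catl u [:: b]); rewrite cats1; exact: path_sorted ru.
have uJ : of_word (a :: rcons u b) ^ of_word [:: a] = of_word u.
  have -> : of_word (a :: rcons u b) =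
      of_word [:: a] * (of_word u * of_word [:: b]).
    by rewrite -!of_word_cat cats1.
  have -> : of_word [:: b] = (of_word [:: a])^-1.
    rewrite -of_word_inv /word_inv /= ab.
    by rewrite -/(letter_inv _) -/(letter_inv b) letter_invK.
  by rewrite /conjg !mulgA mulVg mul1g mulgVK.
have [||g [c [cyc e]]] := IH u ru'.
- by move: un; rewrite /= size_rcons; lia.
- by rewrite -uJ conjg_eq1.
by exists (of_word [:: a] * g), c; rewrite conjgM uJ.
Qed.

(** After conjugation [x] is a cyclically reduced [c], and every power of [y] is a power of [c]
    times one of finitely many prefixes. By pigeonhole two distinct powers share the prefix, which
    cancels in their quotient. *)
Lemma free_group_commute (x y : free_group X) :
  x != 1 -> commute x y ->
  exists2 b : int, b != 0%R & exists a : int, intexp y b = intexp x a.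
Proof.
move=> /conj_cyclically_reduced[g [c [cyc xc]]] xy.
suff [b b0 [a e]] : exists2 b : int, b != 0%R &
    exists a : int, intexp (y ^ g) b = intexp (x ^ g) a.
  by exists b => //; exists a; apply: (@conjg_inj _ g); rewrite -!intexpJ.
have cyk k : commute (of_word c) ((y ^ g) ^+ k).
  by apply: commuteX; rewrite -xc /commute -!conjMg xy.
have /choice[q qP] (k : nat) : exists q : int * ('I_(size c).+1 * bool),
    (y ^ g) ^+ k = intexp (x ^ g) q.1 *
      of_word (take q.2.1 (if q.2.2 then c else word_inv c)).
  have [u ru uE] := reducedP ((y ^ g) ^+ k).
  have := cyk k; rewrite uE xc => /centralizer_axis[] // m [j [s e]].
  by exists (m, (j, s)).
pose N := #|{: 'I_(size c).+1 * bool}|.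
have /injectivePn[k [l kl e]] : ~~ injectiveb (fun k : 'I_N.+1 => (q k).2).
  apply/injectiveP => /leq_card; rewrite card_ord -/N; lia.
exists (k%:Z - l%:Z)%R; first by rewrite subr_eq0.
exists ((q k).1 - (q l).1)%R; rewrite !intexpD !intexpN /= !qP e.
by rewrite invgM mulgA mulgK.
Qed.

End ReducedWords.

(** * Lower bound: ranks of free abelian subgroups *)

(** A factor of the tower becomes a total function on [G], multiplicative on [B] only, so that no
    subgroup types occur in the rank induction. *)
Lemma factor_group_morphism (G H : groupType) (A B : groupClosed G)
    (nAB : normal_in A B) :
  isomorphic (factor_group nAB) H ->
  exists2 p : G -> H, {in B &, {morph p : x y / x * y}} &
    {in B, forall x, (p x = 1) <-> (x \in A)}.
Proof.
move=> [f fbij]; have finj := bij_inj fbij.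
(* Elements outside [B] get the default value 1. *)
pose lift x : subgroup_of B := insubd 1 x.
have liftK : {in B, forall x, val (lift x) = x} by exact: insubdK.
have inA x : x \in B ->
    (lift x \in NormalSubgroup (in_subgroupJ nAB)) = (x \in A).
  by move=> xB; rewrite -[in RHS](liftK _ xB).
pose proj x : factor_group nAB :=
  coset (NormalSubgroup (in_subgroupJ nAB)) (lift x).
have projM : {in B &, {morph proj : x y / x * y}}.
  move=> x y xB yB; rewrite /proj -cosetM; congr coset; apply: val_inj.
  by rewrite valM !liftK // gpredM.
exists (f \o proj) => [x y xB yB | x xB] /=; first by rewrite projM ?gmulfM.
have f1 : f 1 = 1 by apply/morph_group1/gmulfM.
rewrite -f1; split=> [/finj/esym/coset_eqP | xA].
  by rewrite invg1 mul1g inA.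
by congr (f _); apply/esym/coset_eqP; rewrite invg1 mul1g inA.
Qed.

Section AdditiveExponents.
Variables (G : groupType) (n : nat) (f : 'rV[int]_n -> G).
Hypothesis fD : {morph f : u v / (u + v)%R >-> u * v}.

Lemma exponent0 : f 0%R = 1.
Proof. by apply: (mulgI (f 0%R)); rewrite -fD addr0 mulg1. Qed.

Lemma exponentN u : f (- u)%R = (f u)^-1.
Proof. by apply: (mulgI (f u)); rewrite -fD subrr mulgV exponent0. Qed.

Lemma exponentZ a u : f (a *: u)%R = intexp (f u) a.
Proof.
elim/int_rect: a => [|k IH|k IH]; first by rewrite scale0r exponent0.
- by rewrite [Posz _]intS addrC scalerDl scale1r fD intexp_succ IH.
- by rewrite intS opprD addrC scalerDl scaleN1r fD exponentN intexp_pred IH.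
Qed.

Lemma exponentC u v : commute (f u) (f v).
Proof. by rewrite /commute -!fD addrC. Qed.

End AdditiveExponents.

(* A tower of length N bounds the rank of free abelian subgroups by N: the image
   of 'Z^n in the top free quotient is abelian, hence cyclic, so its kernel
   contains a copy of 'Z^(n-1). *)
Lemma tower_relation (G : groupType) (T : nat -> groupClosed G) (N n : nat)
    (f : 'rV[int]_n -> G) :
  T 0 =i pred1 1 ->
  (forall i, i < N -> exists nT : normal_in (T i) (T i.+1),
     is_free_group (factor_group nT)) ->
  {morph f : u v / (u + v)%R >-> u * v} -> (forall u, f u \in T N) ->
  N < n -> exists2 u, u != 0%R & f u = 1.
Proof.
move=> T0; elim: N n f => [|N IH] n f Tfree fD fT Nn.
  case: n f fD fT Nn => // n f fD fT _.
  exists (delta_mx 0 0)%R; last first.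
    by have := fT (delta_mx 0 0)%R; rewrite T0 => /eqP.
  by apply/eqP => /matrixP/(_ 0%R 0%R); rewrite !mxE eqxx.
have [nT [X /factor_group_morphism[p pM pA]]] := Tfree N (ltnSn N).
case: n f fD fT Nn => // n f fD fT Nn.
pose g u := p (f u).
have gD : {morph g : u v / (u + v)%R >-> u * v}.
  by move=> u v; rewrite /g fD pM.
pose d i : 'rV[int]_n.+1 := delta_mx 0%R i.
(* The pivot [j] is a coordinate with nontrivial image under [g], and every other image has a
   nonzero power in common with it. If all images are trivial, any pivot does, with coefficients 0
   and 1. *)
have [j jP] : exists j, forall i, exists ab : int * int, ab.2 != 0%R /\
    g (ab.2 *: d i - ab.1 *: d j)%R = 1.
  have [[j gj]|g1] := pselect (exists j, g (d j) != 1).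
    exists j => i.
    have [b b0 [a e]] := free_group_commute gj (exponentC gD _ (d i)).
    exists (a, b); split=> //=.
    by rewrite gD exponentN // !exponentZ // e mulgV.
  exists ord0 => i; exists (0%R, 1%R); split=> //=.
  rewrite scale0r subr0 scale1r; apply/eqP/negP => gi; apply: g1; exists i.
  exact/negP.
have [ab abP] := choice jP.
pose e i := ((ab (lift j i)).2 *: d (lift j i) - (ab (lift j i)).1 *: d j)%R.
(* [M] embeds the lattice of rank one less into the kernel of [g]. *)
pose M (w : 'rV[int]_n) : 'rV[int]_n.+1 := (\sum_i w ord0 i *: e i)%R.
have MD u v : M (u + v)%R = (M u + M v)%R.
  by rewrite /M -big_split; apply: eq_bigr => i _; rewrite mxE scalerDl.
have gM w : g (M w) = 1.
  rewrite /M; elim/big_ind: _ => [|u v gu gv|i _]; first exact: exponent0.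
    by rewrite gD gu gv mulg1.
  rewrite exponentZ // (abP _).2.
  by case: (w _ _) => k /=; rewrite expg1n ?invg1.
have [|u v|w|//|w w0 fw] := IH n (f \o M).
- by move=> i iN; apply: Tfree; apply: ltnW.
- by rewrite /= MD fD.
- by apply/(pA _ (fT _)); apply: gM.
exists (M w) => //; apply: contra w0 => /eqP/rowP Mw; apply/eqP/rowP => i.
(* Away from the pivot, coordinate [lift j i] of [M w] is [w ord0 i] times a nonzero coefficient, so
   [M] is injective. *)
have := Mw (lift j i); rewrite /M summxE (bigD1 i) //= big1 ?addr0.
  rewrite !mxE !eqxx [_ == j]eq_sym (negPf (neq_lift j i)) mulr0 subr0 mulr1.
  by move/eqP; rewrite mulf_eq0 (negPf (abP _).1) orbF => /eqP.
move=> k ki; rewrite !mxE !eqxx /= [lift j i == j]eq_sym (negPf (neq_lift j i)).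
by rewrite (inj_eq lift_inj) eq_sym (negPf ki) !mulr0.
Qed.

Lemma free_gen_intexp_eq1 (X : Type) (x : X) (m : int) :
  intexp (free_gen x) m = 1 -> m = 0%R.
Proof.
have gen_exp n : free_gen x ^+ n = of_word (nseq n (x : {classic X}, true)).
  elim: n => [//|n IH]; rewrite expgS IH.
  by symmetry; apply: (@of_word_cat X [:: (x, true)]).
have red n : reduced (nseq n (x : {classic X}, true)).
  case: n => //; elim=> //= n; rewrite /reduced /= => ->.
  by rewrite xpair_eqE andbF.
have exp1 n : free_gen x ^+ n = 1 -> n = 0.
  rewrite gen_exp => e.
  have /(congr1 size) : nseq n (x : {classic X}, true) = [::].
    exact: of_word_inj.
  by rewrite size_nseq.
case: m => n /=; first by move=> /exp1 n0; rewrite n0.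
by move=> /eqP; rewrite invg_eq1 => /eqP/exp1.
Qed.

(** Exponent [i] is read off in an infinite cyclic group, the free group on [unit], after killing
    every generator other than [v i]. *)
Lemma raag_clique_independent (Gamma : graph) (q : nat) (v : 'I_q -> Gamma) :
  injective v ->
  forall u : 'rV[int]_q,
    \prod_i intexp (raag_gen (v i)) (u ord0 i) = 1 -> u = 0%R.
Proof.
move=> vinj u u1; apply/rowP => i; rewrite mxE.
pose h (w : Gamma) : free_group unit :=
  if pselect (w = v i) then free_gen tt else 1.
have hC x y : edge x y -> commute (h x) (h y).
  move=> _; rewrite /h; case: pselect => xv; case: pselect => yv //.
  - exact: commute1.
  - exact/commute_sym/commute1.
apply: (@free_gen_intexp_eq1 _ tt).
have := congr1 (raag_lift hC) u1; rewrite gmulf_prod gmulf1 => <-.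
under [RHS]eq_bigr => j _.
  rewrite gmulf_intexp /= raag_lift_gen.
  have -> : intexp (h (v j)) (u ord0 j) =
      if j == i then intexp (free_gen tt) (u ord0 j) else 1.
    rewrite /h; case: pselect => [vji | vji] /=.
      by rewrite (vinj _ _ vji) eqxx.
    case: eqP => [ji|_]; first by case: vji; rewrite ji.
    by case: (u _ _) => k /=; rewrite expg1n ?invg1.
  over.
by rewrite -big_mkcond big_pred1_eq.
Qed.

Lemma raag_tower_clique (Gamma : graph) (q N : nat) :
  (exists2 K : set Gamma, clique K & (K #= `I_q)%card) ->
  has_poly_free_tower (raag Gamma) N -> q <= N.
Proof.
move=> [K Kcl /card_set_bijP[r [_ _ rsurj]]] [T [T0 TN Tfree]].
have /choice[v vP] (i : 'I_q) : exists x, K x /\ r x = i.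
  by have [x Kx rx] := rsurj i (ltn_ord i); exists x.
have vK i : K (v i) by have [] := vP i.
have vinj : injective v.
  move=> i j e; apply: val_inj.
  by have [_ /= <-] := vP i; have [_ <-] := vP j; rewrite e.
have vC i j : commute (raag_gen (v i)) (raag_gen (v j)).
  have [->|ij] := eqVneq i j; first exact: commute_refl.
  by apply/raag_genC/Kcl => // /vinj/eqP; rewrite (negPf ij).
rewrite leqNgt; apply/negP => Nq.
pose f (u : 'rV[int]_q) := \prod_i intexp (raag_gen (v i)) (u ord0 i).
have fD : {morph f : u w / (u + w)%R >-> u * w}.
  move=> u w; rewrite /f -prodgM_commute; last first.
    move=> i j _ _; apply/commute_intexp/commute_sym/commute_intexp.
    exact: vC.
  by apply: eq_bigr => i _; rewrite mxE intexpD.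
have [|u u0 /raag_clique_independent] := tower_relation T0 Tfree fD _ Nq.
  by move=> u; rewrite TN.
by move/(_ vinj)/eqP; rewrite (negPf u0).
Qed.

(** * Morphisms agreeing on generators, and recognition of factors *)

Lemma free_morph_ext (X : Type) (G : groupType) (f g : free_group X -> G) :
  {morph f : x y / x * y} -> {morph g : x y / x * y} ->
  (forall x, f (free_gen x) = g (free_gen x)) -> f =1 g.
Proof.
move=> fM gM fg; apply: free_group_ind => [|x y ex ey|x ex|//].
- by rewrite !morph_group1.
- by rewrite fM gM ex ey.
- by rewrite !morph_groupV // ex.
Qed.

Lemma raag_morph_ext (Gamma : graph) (G : groupType) (f g : raag Gamma -> G) :
  {morph f : x y / x * y} -> {morph g : x y / x * y} ->
  (forall v, f (raag_gen v) = g (raag_gen v)) -> f =1 g.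
Proof.
move=> fM gM fg; apply: raag_ind => [|x y ex ey|x ex|//].
- by rewrite !morph_group1.
- by rewrite fM gM ex ey.
- by rewrite !morph_groupV // ex.
Qed.

(** The factor and [F] are compared inside [H]: the map induced by [f] and the map [p] are both
    injective, with the same image. *)
Lemma factor_group_isomorphic (G H F : groupType) (A B : groupClosed G)
    (nAB : normal_in A B) (f : G -> H) (p : F -> H) :
  {morph f : x y / x * y} -> {in B, forall x, (f x = 1) <-> (x \in A)} ->
  {morph p : x y / x * y} -> injective p ->
  (forall x, x \in B -> exists a, p a = f x) ->
  (forall a, exists2 x, x \in B & f x = p a) ->
  isomorphic (factor_group nAB) F.
Proof.
move=> fM fA pM pinj fp pf.
have fV := morph_groupV fM.
have /choice[h hP] (q : factor_group nAB) :
    exists a, p a = f (val (repr q : subgroup_of B)).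
  exact/fp/(valP (repr q : subgroup_of B)).
pose N := NormalSubgroup (in_subgroupJ nAB).
have hE (x : subgroup_of B) : p (h (coset N x)) = f (val x).
  rewrite hP; set y : subgroup_of B := repr _.
  have : x^-1 * y \in N by apply: repr_coset.
  rewrite -[_ \in _]/(val (x^-1 * y) \in A) => /(fA _ (valP (x^-1 * y))).
  by rewrite valM gmulfV fM fV => /mulg1_eq; rewrite invgK.
have hM : {morph h : x y / x * y}.
  elim/cosetW => x; elim/cosetW => y; apply: pinj.
  by rewrite -cosetM pM !hE valM fM.
have [g gh] := group_morphism hM; exists g.
have /choice[k kP] a : exists q, h q = a.
  have [x xB fx] := pf a; exists (coset N (exist _ x xB)).
  by apply: pinj; rewrite hE.
exists k => x; last by rewrite gh kP.
move: x; elim/cosetW => x; move: (kP (g (coset N x))).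
elim/cosetW: (k _) => y; rewrite gh => /(congr1 p); rewrite !hE => e.
apply/coset_eqP; rewrite -[_ \in _]/(val (y^-1 * x) \in A).
by apply/(fA _ (valP (y^-1 * x))); rewrite valM gmulfV fM fV e mulVg.
Qed.

(** * The group of permutations of a type *)

Section Bijections.
Variable T : Type.

Record bijection := Bijection {
  bij_fun :> T -> T;
  bij_inv : T -> T;
  bij_funK : cancel bij_fun bij_inv;
  bij_invK : cancel bij_inv bij_fun
}.

HB.instance Definition _ := gen_eqMixin bijection.
HB.instance Definition _ := gen_choiceMixin bijection.

Lemma bijectionP (s t : bijection) : s =1 t -> s = t.
Proof.
case: s t => [s s' sK s'K] [t t' tK t'K] /= /funext st.
have st' : s' = t' by apply/funext => x; rewrite -{1}[x]t'K -st sK.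
case: _ / st in tK t'K *; case: _ / st' in tK t'K *.
by congr Bijection; apply: Prop_irrelevance.
Qed.

Definition bij_one := @Bijection id id (frefl _) (frefl _).
(** The underlying function is [s \o t], so morphisms into this group are left actions. *)
Definition bij_mul (s t : bijection) : bijection :=
  Bijection (can_comp (bij_funK s) (bij_funK t))
            (can_comp (bij_invK t) (bij_invK s)).
Definition bij_opp (s : bijection) : bijection :=
  Bijection (bij_invK s) (bij_funK s).

Lemma bij_mulA : associative bij_mul.
Proof. by move=> s t r; apply: bijectionP. Qed.

Lemma bij_mul1 : left_id bij_one bij_mul.
Proof. by move=> s; apply: bijectionP. Qed.

Lemma bij_mulr1 : right_id bij_one bij_mul.
Proof. by move=> s; apply: bijectionP. Qed.

Lemma bij_mulV : left_inverse bij_one bij_opp bij_mul.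
Proof. by move=> s; apply: bijectionP => x; apply: bij_funK. Qed.

Lemma bij_mulrV : right_inverse bij_one bij_opp bij_mul.
Proof. by move=> s; apply: bijectionP => x; apply: bij_invK. Qed.

HB.instance Definition _ := isGroup.Build bijection
  bij_mulA bij_mul1 bij_mulr1 bij_mulV bij_mulrV.

End Bijections.

(** * Translations and relabellings of the free group over a group *)

Section FreeGroupActions.
Variable G : groupType.
Implicit Types (x g : G) (a : free_group G).

Definition translation a : bijection (free_group G) :=
  Bijection (mulKg a) (mulVKg a).

Lemma translationM : {morph translation : a b / a * b}.
Proof. by move=> a b; apply: bijectionP => y /=; rewrite -mulgA. Qed.

(** Conjugating labels by the inverse of [g] makes this a left action. *)
Definition free_conj g : free_group G -> free_group G :=
  free_lift (fun x => free_gen (x ^ g^-1)).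

Lemma free_conjM g : {morph free_conj g : a b / a * b}.
Proof. exact: free_liftM. Qed.

Lemma free_conj_gen g x : free_conj g (free_gen x) = free_gen (x ^ g^-1).
Proof. exact: free_lift_gen. Qed.

Lemma free_conj_comp g h a : free_conj g (free_conj h a) = free_conj (g * h) a.
Proof.
move: a; apply: free_morph_ext => [a b|a b|x]; rewrite ?free_conjM //.
by rewrite !free_conj_gen invgM conjgM.
Qed.

Lemma free_conj1 a : free_conj 1 a = a.
Proof.
move: a; apply: free_morph_ext => [a b|//|x]; first exact: free_conjM.
by rewrite free_conj_gen invg1 conjg1.
Qed.

Lemma free_conjK g : cancel (free_conj g) (free_conj g^-1).
Proof. by move=> a; rewrite free_conj_comp mulVg free_conj1. Qed.

Lemma free_conjVK g : cancel (free_conj g^-1) (free_conj g).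
Proof. by move=> a; rewrite free_conj_comp mulgV free_conj1. Qed.

Definition relabeling g : bijection (free_group G) :=
  Bijection (free_conjK g) (free_conjVK g).

Lemma relabelingM : {morph relabeling : g h / g * h}.
Proof. by move=> g h; apply: bijectionP => y /=; rewrite free_conj_comp. Qed.

(** Relabellings conjugate these translations as elements of [G] conjugate their labels; this yields
    both the mixed commutation relations and the action of a conjugate of a generator. *)
Lemma translationJ x g :
  translation (free_gen x) ^ relabeling g = translation (free_gen (x ^ g)).
Proof.
rewrite /conjg -(morph_groupV relabelingM); apply: bijectionP => y /=.
by rewrite free_conjM free_conj_gen invgK free_conjK.
Qed.

End FreeGroupActions.

(** * Upper bound: the tower of a proper colouring *)

Section ColorTower.
Variables (Gamma : graph) (c : Gamma -> nat).
Hypothesis c_proper : forall v w, edge v w -> c v <> c w.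

Notation G := (raag Gamma).

Definition truncated_gen i v : G := if i <= c v then raag_gen v else 1.

Lemma truncated_genC i v w :
  edge v w -> commute (truncated_gen i v) (truncated_gen i w).
Proof.
move=> vw; rewrite /truncated_gen; case: ifP => _; case: ifP => _ //.
- exact: raag_genC.
- exact: commute1.
- exact/commute_sym/commute1.
Qed.

Definition truncation i : UMagmaMorphism.type G G :=
  raag_lift (@truncated_genC i).

Lemma truncation_gen i v :
  truncation i (raag_gen v) = if i <= c v then raag_gen v else 1.
Proof. exact: raag_lift_gen. Qed.

(** This gives both idempotence and the nesting of the kernels. *)
Lemma truncation_comp i j g :
  truncation i (truncation j g) = truncation (maxn i j) g.
Proof.
move: g; apply: raag_morph_ext => [x y|x y|v]; rewrite ?gmulfM //.
rewrite !truncation_gen geq_max; case: (j <= _); last by rewrite andbF gmulf1.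
by rewrite truncation_gen andbT.
Qed.

Lemma truncation0 g : truncation 0 g = g.
Proof.
move: g; apply: raag_morph_ext => [x y|//|v]; first by rewrite gmulfM.
by rewrite truncation_gen.
Qed.

Lemma truncation_big k g : (forall v, c v < k) -> truncation k g = 1.
Proof.
move=> ck; move: g; apply: (raag_morph_ext (g := fun=> 1)) => [x y|x y|v].
- by rewrite gmulfM.
- by rewrite mulg1.
- by rewrite truncation_gen leqNgt ck.
Qed.

Section Layer.
Variable i : nat.

Definition in_layer (x : G) : Prop :=
  exists s g, c s = i /\ x = raag_gen s ^ truncation i.+1 g.

(** The basis consists of elements of [G], not of pairs [(s, g)], since different pairs may give the
    same conjugate. *)
Definition layer : Type := {x : G | in_layer x}.

Definition layer_val : free_group layer -> G :=
  free_lift (fun x => proj1_sig x).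

Lemma layer_valM : {morph layer_val : a b / a * b}.
Proof. exact: free_liftM. Qed.

Lemma layer_val_gen x : layer_val (free_gen x) = proj1_sig x.
Proof. exact: free_lift_gen. Qed.

(** Labels range over all of [G], not only over the layer, so relabelling needs no stability
    check. *)
Definition layer_action_gen (v : Gamma) : bijection (free_group G) :=
  if c v < i then 1 else if c v == i then translation (free_gen (raag_gen v))
  else relabeling (raag_gen v).

Lemma layer_action_genC v w :
  edge v w -> commute (layer_action_gen v) (layer_action_gen w).
Proof.
have mixed x y : edge x y ->
    commute (translation (free_gen (raag_gen x))) (relabeling (raag_gen y)).
  move=> xy; apply/commgP; rewrite -conjg_fix translationJ.
  by have /commgP := raag_genC xy; rewrite -conjg_fix => /eqP->.
move=> vw; rewrite /layer_action_gen.
case: ifP => _; first exact/commute_sym/commute1.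
case: ifP => [/eqP vi|_]; (case: ifP => _; first exact: commute1).
  (* Translations by two distinct free generators would not commute; properness of the colouring
     excludes this case. *)
  case: ifP => [/eqP wi|_]; last exact: mixed.
  by case: (c_proper vw); rewrite vi wi.
case: ifP => _; first exact/commute_sym/mixed/edge_sym.
by rewrite /commute -!relabelingM (raag_genC vw).
Qed.

Definition layer_action : UMagmaMorphism.type G (bijection (free_group G)) :=
  raag_lift layer_action_genC.

Lemma layer_action_lift_gen v : layer_action (raag_gen v) = layer_action_gen v.
Proof. exact: raag_lift_gen. Qed.

Lemma layer_action_truncation g :
  layer_action (truncation i.+1 g) = relabeling (truncation i.+1 g).
Proof.
move: g; apply: raag_morph_ext => [x y|x y|v]; rewrite ?gmulfM ?relabelingM //.
rewrite truncation_gen; case: ifP => cv.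
  by rewrite layer_action_lift_gen /layer_action_gen ltnNge ltnW ?gtn_eqF.
by rewrite gmulf1 (morph_group1 (@relabelingM _)).
Qed.

Lemma layer_action_layer (x : layer) :
  layer_action (proj1_sig x) = translation (free_gen (proj1_sig x)).
Proof.
have [s [g [si ->]]] := proj2_sig x.
rewrite gmulfJ /= layer_action_truncation layer_action_lift_gen.
by rewrite /layer_action_gen si ltnn eqxx translationJ.
Qed.

(** The element [layer_val a] acts as translation by [incl a], so its value at 1 recovers [incl a],
    and [incl] has a left inverse. *)
Lemma layer_val_inj : injective layer_val.
Proof.
pose incl : free_group layer -> free_group G :=
  free_lift (fun x => free_gen (proj1_sig x)).
(* Generators with label outside the layer are killed. *)
pose retr : free_group G -> free_group layer :=
  free_lift (fun g => if pselect (in_layer g) is left gl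
                      then free_gen (exist _ g gl) else 1).
have inclK : cancel incl retr.
  apply: free_morph_ext => [a b|//|[x xl]].
    by rewrite /incl /retr !free_liftM.
  rewrite /incl /retr !free_lift_gen /=; case: pselect => // xl'.
  by congr (free_gen (exist _ _ _)); apply: Prop_irrelevance.
have act : layer_action \o layer_val =1 @translation G \o incl.
  apply: free_morph_ext => [a b|a b|x] /=.
  - by rewrite layer_valM gmulfM.
  - by rewrite /incl free_liftM translationM.
  - by rewrite layer_val_gen layer_action_layer /incl free_lift_gen.
move=> a b ab; apply: (can_inj inclK).
have := act b; rewrite /= -ab; have /= -> := act a.
by move=> /(congr1 (fun s : bijection _ => s 1)) /=; rewrite !mulg1.
Qed.

(** The image of the next retraction normalizes the subgroup generated by the layer, because it
    permutes the layer. *)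
Lemma layer_valJ a g :
  exists b, layer_val b = layer_val a ^ truncation i.+1 g.
Proof.
move: a; apply: free_group_ind => [|a b [a' ea] [b' eb]|a [a' ea]|[x xl]].
- by exists 1; rewrite (morph_group1 layer_valM) conj1g.
- by exists (a' * b'); rewrite !layer_valM conjMg ea eb.
- by exists a'^-1; rewrite !(morph_groupV layer_valM) conjVg ea.
have xJl : in_layer (x ^ truncation i.+1 g).
  case: xl => s [g' [si ->]]; exists s, (g' * g).
  by rewrite -conjgM -gmulfM.
by exists (free_gen (exist _ _ xJl)); rewrite !layer_val_gen.
Qed.

(** Half of a semidirect decomposition: the image of retraction [i] is the subgroup generated by the
    layer times the image of retraction [i.+1]. On the kernel of the latter, only the first factor
    remains. *)
Lemma truncation_layer g :
  exists a, truncation i g = layer_val a * truncation i.+1 g.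
Proof.
move: g; apply: raag_ind => [|x y [a ea] [b eb]|x [a ea]|v].
- by exists 1; rewrite !gmulf1 (morph_group1 layer_valM) mulg1.
- have [b' e] := layer_valJ b x^-1.
  (* In [a h b k], with [h] and [k] the truncations of [x] and [y], the factor [b] moves left past
     [h] and becomes its conjugate [b']. *)
  exists (a * b'); rewrite layer_valM e !gmulfM ea eb gmulfV /conjg invgK.
  by rewrite !mulgA mulgVK.
- have [a' e] := layer_valJ a^-1 x; exists a'.
  rewrite e !gmulfV ea (morph_groupV layer_valM) invgM /conjg.
  by rewrite !mulgA mulgK.
rewrite !truncation_gen; case: ltngtP => cv.
- by exists 1; rewrite (morph_group1 layer_valM) mul1g.
- by exists 1; rewrite (morph_group1 layer_valM) mul1g.
have vl : in_layer (raag_gen v) by exists v, 1; rewrite gmulf1 conjg1 cv.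
by exists (free_gen (exist _ _ vl)); rewrite layer_val_gen mulg1.
Qed.

Lemma truncation_layer_val a : truncation i (layer_val a) = layer_val a.
Proof.
move: a; apply: free_morph_ext => [a b|a b|[x xl]];
  rewrite ?layer_valM ?gmulfM //.
rewrite layer_val_gen /=; case: xl => s [g [si ->]].
rewrite gmulfJ /= truncation_gen si leqnn truncation_comp.
by rewrite (maxn_idPr (leqnSn i)).
Qed.

Lemma truncationS_layer_val a : truncation i.+1 (layer_val a) = 1.
Proof.
move: a; apply: (free_morph_ext (g := fun=> 1)) => [a b|a b|[x xl]].
- by rewrite layer_valM gmulfM.
- by rewrite mulg1.
rewrite layer_val_gen /=; case: xl => s [g [si ->]].
by rewrite gmulfJ /= truncation_gen si ltnn conj1g.
Qed.

Lemma layer_normal :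
  normal_in (kernel (truncation i)) (kernel (truncation i.+1)).
Proof.
split=> [x|x y xi _]; last exact: kernelJ.
rewrite !kernelE => /eqP xi.
by rewrite -(maxn_idPl (leqnSn i)) -truncation_comp xi gmulf1.
Qed.

Lemma layer_factor_free : is_free_group (factor_group layer_normal).
Proof.
exists layer.
apply: (@factor_group_isomorphic _ _ _ _ _ _ (truncation i) layer_val).
- exact: gmulfM.
- by move=> x _; rewrite kernelE; split=> /eqP.
- exact: layer_valM.
- exact: layer_val_inj.
- move=> x; rewrite kernelE => /eqP xi.
  by have [a ->] := truncation_layer x; exists a; rewrite xi mulg1.
- move=> a; exists (layer_val a); last exact: truncation_layer_val.
  by rewrite kernelE truncationS_layer_val.
Qed.

End Layer.

Lemma color_tower k : (forall v, c v < k) -> has_poly_free_tower G k.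
Proof.
move=> ck; exists (fun i => kernel (truncation i) : groupClosed G).
split=> [x|x|i _].
- by rewrite kernelE truncation0.
- by rewrite kernelE truncation_big ?eqxx.
- by exists (layer_normal i); apply: layer_factor_free.
Qed.

End ColorTower.

Theorem theoremA (Gamma : graph) (clq chr : nat) :
  is_clq Gamma clq -> is_chr Gamma chr ->
  [/\ poly_free (raag Gamma),
      (exists2 pfl : nat, is_pfl (raag Gamma) pfl & clq <= pfl <= chr) &
      has_poly_free_tower (raag Gamma) chr].
Proof.
move=> [clqK _] [[c c_proper] _].
have tower : has_poly_free_tower (raag Gamma) chr.
  apply: (@color_tower _ (fun v => c v)) => [v w /c_proper vw /val_inj //|v].
  exact: ltn_ord.
split=> //; first by exists chr.
(* The colour tower makes the set of tower lengths nonempty, so a least length exists. *)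
have ex_tower : exists n, `[< has_poly_free_tower (raag Gamma) n >].
  by exists chr; apply/asboolP.
have [pfl /asboolP pflT pfl_min] := ex_minnP ex_tower.
exists pfl; first by split=> // m mT; apply/pfl_min/asboolP.
by rewrite (raag_tower_clique clqK pflT) pfl_min //; apply/asboolP.
Qed.
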